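(* Let $m,c,d>0$ be constants and, for $z>0$, let $$\mu(z)=\frac{30\,mc}{d}\,\frac{z^{6}}{\left(2z^{2}+4z+1\right)^{2}}\,\mathcal{I}(z)^{-1},\qquad \mathcal{I}(z)=\int_{2/z}^{\infty}e^{-\left(x-\frac{2}{z}\right)}\left(\frac{1}{x}+\frac{3}{x^{2}}+\frac{3}{x^{3}}\right)\left(z^{2}x^{2}-4\right)^{5/2}dx .$$ Then $\mu(z)\to 0^{+}$ as $z\to +\infty$.
   Context: The function $\mu$ is the bulk viscosity of a two-dimensional relativistic gas of hard disks, as a function of the relativistic parameter $z=kT/(mc^{2})>0$; here $m$ (particle mass), $c$ (speed of light) and $d$ (hard-disk parameter in the cross section) are positive real constants. The notation $\mu(z)\to 0^{+}$ means that $\mu(z)$ tends to $0$ through positive values, i.e. the limit is $0$ and $\mu(z)>0$ for all sufficiently large $z$. *)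

(* Defs.v *)
From mathcomp Require Import all_boot all_order all_algebra.
From mathcomp Require Import all_classical all_reals all_analysis.
Import Order.TTheory GRing.Theory Num.Theory.
Import numFieldNormedType.Exports.

Set Implicit Arguments.
Unset Strict Implicit.
Unset Printing Implicit Defensive.

Local Open Scope classical_set_scope.
Local Open Scope ring_scope.

(** For [z > 0] the integrand is nonnegative on the domain, so the Lebesgue
    integral is the improper Riemann integral.  [Rintegral] sends a divergent
    integral to [0], and then [bulk_viscosity] is [0] as well: the positivity of
    [bulk_viscosity] at [z > 0] therefore forces the integral to converge. *)
Definition viscosity_integral (R : realType) (z : R) : R :=
  \int[@lebesgue_measure R]_(x in `[2 / z, +oo[)
    (expR (- (x - 2 / z)) * (1 / x + 3 / x ^+ 2 + 3 / x ^+ 3)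
     * (z ^+ 2 * x ^+ 2 - 4) `^ (5 / 2)).

Definition bulk_viscosity (R : realType) (m c d z : R) : R :=
  30 * m * c / d * (z ^+ 6 / (2 * z ^+ 2 + 4 * z + 1) ^+ 2)
  * (viscosity_integral z)^-1.

(* Main.v *)
(** On [[2, 3]] and for [z >= 2] the integrand is at least a constant times
    [z ^+ 4], hence so is the integral; since the rational prefactor is at most
    [z ^+ 3], the viscosity is at most a constant times [z^-1].  Positivity
    amounts to convergence of the integral, which follows from dominating the
    integrand by a multiple of [expR (- (x / 2))]. *)
Require Import Defs.
From mathcomp Require Import all_boot all_order all_algebra.
From mathcomp Require Import ring lra.
From mathcomp Require Import all_classical all_reals all_analysis.
From mathcomp Require Import measurable_realfun.
Import Order.TTheory GRing.Theory Num.Theory.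
Import numFieldNormedType.Exports.
Local Open Scope classical_set_scope.
Local Open Scope ring_scope.

(** Kept convertible to the function under [viscosity_integral], so that bounds on it pass to the
    integral without rewriting. *)
Definition viscosity_integrand {R : realType} (z x : R) : R :=
  expR (- (x - 2 / z)) * (1 / x + 3 / x ^+ 2 + 3 / x ^+ 3)
  * (z ^+ 2 * x ^+ 2 - 4) `^ (5 / 2).

(** Inversion is measurable on []0, +oo[] since it is continuous on that open set; the remaining
    ingredients are measurable everywhere. *)
Lemma measurable_viscosity_integrand {R : realType} (z : R) (D : set R) :
  D `<=` `]0, +oo[ -> measurable_fun D (viscosity_integrand z).
Proof.
pose P : set R := `]0, +oo[%classic.
move=> DP; apply: (@measurable_funS _ _ _ _ P) => //; first exact: measurable_itv.
have mV : measurable_fun P (@GRing.inv R).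
  apply: open_continuous_measurable_fun; first exact: interval_open.
  move=> x; rewrite inE /P/= in_itv/= andbT => x0.
  by apply: inv_continuous; rewrite gt_eqF.
have mVX n (a : R) : measurable_fun P (fun x : R => a / x ^+ n).
  under eq_fun do rewrite -exprVn.
  by apply: measurable_funM => //; exact: measurable_funX.
apply: measurable_funM; first apply: measurable_funM.
- apply: (measurableT_comp (@measurable_expR R)).
  by apply: measurableT_comp => //; exact: measurable_funB.
(* [x ^+ 1] is convertible to [x], so [1 / x] is the case [n = 1]. *)
- by do 2?apply: measurable_funD; [exact: (mVX 1%N)|exact: mVX..].
- apply: (measurableT_comp (@measurable_powR R (5 / 2))).
  by apply: measurable_funB => //; exact: measurable_funM.
Qed.

Lemma viscosity_integrand_ge0 {R : realType} (z x : R) :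
  0 < x -> 0 <= viscosity_integrand z x.
Proof.
move=> x0; rewrite /viscosity_integrand !mulr_ge0 ?expR_ge0 ?powR_ge0//.
by rewrite !addr_ge0// divr_ge0// ?exprn_ge0// ltW.
Qed.

(** On nonnegative reals this function is twice the exponential density of rate [2^-1]. *)
Lemma integrable_expRNhalf {R : realType} (a : R) : 0 <= a ->
  (@lebesgue_measure R).-integrable `[a, +oo[
    (EFin \o (fun x => expR (- (x / 2)))).
Proof.
move=> a0.
have half0 : 0 < 2^-1 :> R by [].
have pdf_int := integrableZl measurableT 2 (integrable_exponential_pdf half0).
have {pdf_int} : (@lebesgue_measure R).-integrable `[a, +oo[
    (fun x => (2 * (exponential_pdf 2^-1 x)%:E)%E).
  by apply: integrableS pdf_int => //; exact: measurable_itv.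
apply: eq_integrable => // x; rewrite inE/= in_itv/= andbT => ax.
rewrite exponential_pdfE ?(le_trans a0)// -EFinM; congr EFin.
by rewrite mulrA divff// mul1r mulNr mulrC.
Qed.

(** On the domain [z * x >= 2], so [x^-1 <= z] controls the rational factor, while half of the
    exponential decay pays for the power. The constant may depend on [z]: only convergence at fixed
    [z] is at stake. *)
Lemma viscosity_integrand_le {R : realType} (z x : R) :
  0 < z -> 2 / z <= x ->
  viscosity_integrand z x <=
    expR (2 / z) * (3 * (1 + z) ^+ 3) * (1 + 12 * z) ^+ 6 * expR (- (x / 2)).
Proof.
move=> z0 zx.
have x0 : 0 < x by rewrite (lt_le_trans _ zx)// divr_gt0.
have zx2 : 2 <= z * x by rewrite mulrC -ler_pdivrMr.
have rat_le : 1 / x + 3 / x ^+ 2 + 3 / x ^+ 3 <= 3 * (1 + z) ^+ 3.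
  have u0 : 0 <= x^-1 by rewrite invr_ge0 ltW.
  have uz : x^-1 <= z.
    by rewrite -[leLHS]mul1r ler_pdivrMr//; lra.
  apply: (@le_trans _ _ (3 * (1 + x^-1) ^+ 3)).
    rewrite -!exprVn; move: (x^-1) u0 => u u0.
    by have := exprn_ge0 2 u0; have := exprn_ge0 3 u0; nra.
  by rewrite ler_pM2l// lerXn2r ?nnegrE; lra.
(* [x ^+ 6] is absorbed by [(1 + x / 12) ^+ 6 <= expR (x / 2)]. *)
have pow_le : (z ^+ 2 * x ^+ 2 - 4) `^ (5 / 2) <=
    (1 + 12 * z) ^+ 6 * expR (x / 2).
  (* The larger base [(1 + z * x) ^+ 2] is at least 1, so the exponent [5 / 2] can be raised to the
     integer 3. *)
  apply: (@le_trans _ _ (((1 + z * x) ^+ 2) ^+ 3)).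
    rewrite -[leRHS]powR_mulrn ?sqr_ge0//.
    apply: (@le_trans _ _ (((1 + z * x) ^+ 2) `^ (5 / 2))).
      by rewrite -exprMn; apply: ge0_ler_powR; rewrite ?nnegrE ?sqr_ge0//; nra.
    apply: ler_powR; last by lra.
    by rewrite expr_ge1//; lra.
  rewrite -exprM -[leRHS](_ : ((1 + 12 * z) * expR (x / 12)) ^+ 6 = _); last first.
    rewrite exprMn -expRM_natr; congr (_ * expR _); lra.
  rewrite lerXn2r ?nnegrE ?mulr_ge0 ?expR_ge0//; [nra|lra|].
  apply: (@le_trans _ _ ((1 + 12 * z) * (1 + x / 12))); first by nra.
  by rewrite ler_pM2l ?expR_ge1Dx//; lra.
rewrite /viscosity_integrand.
have -> : - (x - 2 / z) = 2 / z - x by lra.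
have expE : expR (2 / z - x) * expR (x / 2) = expR (2 / z) * expR (- (x / 2)).
  by rewrite -!expRD; congr expR; lra.
apply: (@le_trans _ _ (expR (2 / z - x) * (3 * (1 + z) ^+ 3) *
    ((1 + 12 * z) ^+ 6 * expR (x / 2)))).
  apply: ler_pM => //; rewrite ?powR_ge0//.
    rewrite mulr_ge0 ?expR_ge0// !addr_ge0// divr_ge0// ?exprn_ge0// ltW//.
  by rewrite ler_pM2l ?expR_gt0.
rewrite le_eqVlt; apply/orP; left; apply/eqP.
transitivity ((expR (2 / z - x) * expR (x / 2)) *
  (3 * (1 + z) ^+ 3) * (1 + 12 * z) ^+ 6); first by ring.
by rewrite expE; ring.
Qed.

Lemma integrable_viscosity_integrand {R : realType} (z : R) : 0 < z ->
  (@lebesgue_measure R).-integrable `[2 / z, +oo[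
    (EFin \o viscosity_integrand z).
Proof.
move=> z0; have z20 : 0 < 2 / z by rewrite divr_gt0.
set K := expR (2 / z) * (3 * (1 + z) ^+ 3) * (1 + 12 * z) ^+ 6.
have Kint : (@lebesgue_measure R).-integrable `[2 / z, +oo[
    (fun x => (K%:E * (expR (- (x / 2)))%:E)%E).
  apply: integrableZl; first exact: measurable_itv.
  exact: integrable_expRNhalf (ltW z20).
apply: le_integrable Kint; first exact: measurable_itv.
  apply/measurable_EFinP; apply: measurable_viscosity_integrand => x /=.
  by rewrite !in_itv/= !andbT; exact: lt_le_trans.
move=> x /=; rewrite in_itv/= andbT => zx.
have x0 : 0 < x by exact: lt_le_trans zx.
have fK := viscosity_integrand_le z x z0 zx.
have f0 := viscosity_integrand_ge0 z x x0.
by rewrite lee_fin ger0_norm// (le_trans fK)// ler_norm.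
Qed.

(** The three factors are bounded below separately: the exponential by [expR (- 3)], the rational
    one by [1 / x >= 1 / 3], the power by [z ^+ 4]. *)
Lemma viscosity_integrand_ge {R : realType} (z x : R) :
  2 <= z -> 2 <= x <= 3 ->
  expR (- 3) / 3 * z ^+ 4 <= viscosity_integrand z x.
Proof.
move=> z2 /andP[x2 x3].
have x0 : 0 < x by lra.
have z0 : 0 < z by lra.
apply: ler_pM.
- by rewrite divr_ge0 ?expR_ge0.
- by rewrite exprn_ge0// ltW.
- apply: ler_pM; rewrite ?expR_ge0 ?invr_ge0//.
    by have := divr_gt0 (ltr0Sn R 1) z0; rewrite ler_expR; lra.
  apply: (@le_trans _ _ (1 / x)); first by rewrite div1r lef_pV2 ?posrE.
  by rewrite -addrA lerDl addr_ge0// divr_ge0// exprn_ge0// ltW.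
have z4 : 4 <= z ^+ 2 by nra.
have x4 : 4 <= x ^+ 2 by nra.
(* With [u = z ^+ 2] and [v = x ^+ 2] both at least 4, [u * v - 4 >= u]. Lowering the exponent to 2
   then loses a factor [z] but gives an integer power. *)
apply: (@le_trans _ _ ((z ^+ 2) `^ (5 / 2))).
  by rewrite (exprM z 2 2) -[leLHS]powR_mulrn ?sqr_ge0// ler_powR//; lra.
by move: z4 x4; move: (z ^+ 2) (x ^+ 2) => u v u4 v4; apply: ge0_ler_powR;
  rewrite ?nnegrE; nra.
Qed.

Lemma viscosity_integral_ge {R : realType} (z : R) : 2 <= z ->
  expR (- 3) / 3 * z ^+ 4 <= viscosity_integral z.
Proof.
move=> z2; have z0 : 0 < z by lra.
have zle : 2 / z <= 1 by rewrite ler_pdivrMr// mul1r.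
have z20 : 0 < 2 / z by rewrite divr_gt0.
have fint := integrable_viscosity_integrand z z0.
have sub : `[2, 3]%classic `<=` (`[2 / z, +oo[%classic : set R).
  by move=> x /=; rewrite !in_itv/= andbT => /andP[x2 _]; lra.
have fint' : (@lebesgue_measure R).-integrable `[2, 3]
    (EFin \o viscosity_integrand z).
  by apply: integrableS fint => //; exact: measurable_itv.
set k := expR (- 3) / 3 * z ^+ 4.
(* Finiteness is essential here: [fine] would send an infinite integral to 0 and destroy the lower
   bound. *)
rewrite -lee_fin /viscosity_integral /Rintegral fineK; last first.
  exact: integrable_fin_num fint.
apply: (@le_trans _ _ (\int[lebesgue_measure]_(x in `[2%R, 3%R])
    (viscosity_integrand z x)%:E)%E); last first.
  apply: ge0_subset_integral => //.
  - exact: measurable_int fint.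
  - move=> x /=; rewrite in_itv/= andbT => zx.
    by rewrite lee_fin viscosity_integrand_ge0// (lt_le_trans z20).
apply: (@le_trans _ _ (\int[lebesgue_measure]_(x in `[2%R, 3%R]) k%:E)%E).
  rewrite integral_cst//= lebesgue_measure_itv/= lte_fin ltr_nat/=.
  by rewrite -EFinB -EFinM lee_fin; lra.
have k0 : 0 <= k by rewrite mulr_ge0 ?divr_ge0 ?expR_ge0// exprn_ge0// ltW.
apply: ge0_le_integral => //.
- exact: measurable_int fint'.
- move=> x /=; rewrite in_itv/= => x23.
  by rewrite lee_fin viscosity_integrand_ge.
Qed.

(** Both conjuncts of the theorem are read off from this: eventual positivity directly, the limit by
    squeezing. *)
Lemma bulk_viscosity_bounds {R : realType} (m c d z : R) :
  0 < m -> 0 < c -> 0 < d -> 2 <= z ->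
  0 < bulk_viscosity m c d z <= 30 * m * c / d * (3 / expR (- 3)) * z^-1.
Proof.
move=> m0 c0 d0 z2; have z0 : 0 < z by lra.
have e0 := expR_gt0 (- 3 : R).
have I_ge := viscosity_integral_ge z z2.
have lb0 : 0 < expR (- 3) / 3 * z ^+ 4 by rewrite mulr_gt0 ?divr_gt0 ?exprn_gt0.
have I0 := lt_le_trans lb0 I_ge.
have A0 : 0 < 30 * m * c / d by rewrite divr_gt0 ?mulr_gt0.
have q0 : 0 < 2 * z ^+ 2 + 4 * z + 1 by have := sqr_ge0 z; lra.
rewrite /bulk_viscosity; apply/andP; split.
  by rewrite !mulr_gt0 ?invr_gt0 ?exprn_gt0.
rewrite -[leLHS]mulrA -[leRHS]mulrA ler_pM2l//.
apply: (@le_trans _ _ (z ^+ 3 * (expR (- 3) / 3 * z ^+ 4)^-1)).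
  apply: ler_pM; rewrite ?invr_ge0 ?(ltW I0) ?divr_ge0 ?exprn_ge0 ?(ltW z0) ?(ltW q0)//.
    (* After cancelling [z ^+ 3], it remains to bound [z ^+ 3] by a square whose expansion contains
       [16 * z ^+ 3]. *)
    rewrite ler_pdivrMr ?exprn_gt0// (exprD z 3 3) ler_pM2l ?exprn_gt0//.
    by have := exprn_gt0 2 z0; have := exprn_gt0 3 z0; have := exprn_gt0 4 z0; nra.
  by rewrite lef_pV2 ?posrE.
rewrite le_eqVlt; apply/orP; left; apply/eqP; field.
by rewrite !gt_eqF.
Qed.

Theorem theorem2 (R : realType) (m c d : R)
    (hm : 0 < m) (hc : 0 < c) (hd : 0 < d) :
  (bulk_viscosity m c d z @[z --> +oo] --> (0 : R)) /\
  (\forall z \near +oo, 0 < bulk_viscosity m c d z).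
Proof.
have bounds : \forall z \near +oo, 0 < bulk_viscosity m c d z <=
    30 * m * c / d * (3 / expR (- 3)) * z^-1.
  have := nbhs_pinfty_ge (num_real (2 : R)).
  by apply: filterS => z; exact: bulk_viscosity_bounds.
split; last by apply: filterS bounds => z /andP[].
have sandwich : \forall z \near +oo, cst 0 z <= bulk_viscosity m c d z <=
    30 * m * c / d * (3 / expR (- 3)) * z^-1.
  by apply: filterS bounds => z /andP[/ltW -> ->].
apply: (squeeze_cvgr sandwich).
- exact: cvg_cst.
(* Writing the limit as a constant times 0 reduces the claim to [z^-1] tending to 0. *)
- rewrite -[X in _ --> X](mulr0 (30 * m * c / d * (3 / expR (- 3)))).
  apply: cvgMr; apply/(@gtr0_cvgV0 _ _ _ _ id); last exact: cvg_id.
  by apply: nbhs_pinfty_gt; rewrite num_real.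
Qed.
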